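(* Let $\mathscr{C}$ be a category with weak finite products. If $\mathsf{P}:\mathscr{C}^{\mathrm{op}}\to\mathsf{InfSL}$ is a biased elementary doctrine, then its strictification $\mathsf{P}^{s}:\mathscr{C}_{s}^{\mathrm{op}}\to\mathsf{InfSL}$ is a (strict) elementary doctrine. Vice versa, for every (strict) elementary doctrine $R:\mathscr{C}_{s}^{\mathrm{op}}\to\mathsf{InfSL}$, the pre-composition $R\circ S:\mathscr{C}^{\mathrm{op}}\to\mathsf{InfSL}$ with the canonical functor $S:\mathscr{C}\to\mathscr{C}_{s}$ is a biased elementary doctrine.
   Context: **Weak products.** A weak product of objects $X_1,\dots,X_n$ is an object $W$ with arrows $\mathsf{p}_i:W\to X_i$ such that for all arrows $f_i:Z\to X_i$ there is a (not necessarily unique) $h:Z\to W$ with $\mathsf{p}_ih=f_i$ for all $i$. $\mathscr{C}$ has weak finite products if every finite list of objects has a weak product (the empty list giving a weak terminal object). **Biased primary doctrine.** $\mathsf{InfSL}$ is the category of posets with finite meets and finite-meet-preserving maps. A biased primary doctrine is a functor $\mathsf{P}:\mathscr{C}^{\mathrm{op}}\to\mathsf{InfSL}$ with $\mathscr{C}$ having weak finite products. For $f:X\to Y$ write $\mathsf{P}_f:\mathsf{P}(Y)\to\mathsf{P}(X)$; $\top_X$ is the top of $\mathsf{P}(X)$. **Biased elementary doctrine.** A biased primary doctrine with, for every object $X$ and every weak product $X\xleftarrow{\mathsf{p}_1}W\xrightarrow{\mathsf{p}_2}X$, an element $\delta^{(\mathsf{p}_1,\mathsf{p}_2)}\in\mathsf{P}(W)$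 such that: 1. for every $d:X\to W$ with $\mathsf{p}_1d=\mathsf{p}_2d=1_X$, $\top_X\le\mathsf{P}_d\delta^{(\mathsf{p}_1,\mathsf{p}_2)}$; 2. for every $\alpha\in\mathsf{P}(X)$, $\mathsf{P}_{\mathsf{p}_1}\alpha\wedge\delta^{(\mathsf{p}_1,\mathsf{p}_2)}\le\mathsf{P}_{\mathsf{p}_2}\alpha$; 3. for every weak product $X'\xleftarrow{\mathsf{p}'_1}W'\xrightarrow{\mathsf{p}'_2}X'$ and arrows $f:X'\to X$, $g:W'\to W$ with $\mathsf{p}_ig=f\mathsf{p}'_i$ ($i=1,2$), $\delta^{(\mathsf{p}'_1,\mathsf{p}'_2)}\le\mathsf{P}_g\delta^{(\mathsf{p}_1,\mathsf{p}_2)}$; 4. for every weak product $W\xleftarrow{\mathsf{r}_1}U\xrightarrow{\mathsf{r}_2}W$ and $t,t':U\to W$ with $\mathsf{p}_1t=\mathsf{p}_1\mathsf{r}_1$, $\mathsf{p}_2t=\mathsf{p}_1\mathsf{r}_2$, $\mathsf{p}_1t'=\mathsf{p}_2\mathsf{r}_1$, $\mathsf{p}_2t'=\mathsf{p}_2\mathsf{r}_2$: $\mathsf{P}_{\mathsf{r}_1}\delta^{(\mathsf{p}_1,\mathsf{p}_2)}\wedge\mathsf{P}_t\delta^{(\mathsf{p}_1,\mathsf{p}_2)}\wedge\mathsf{P}_{t'}\delta^{(\mathsf{p}_1,\mathsf{p}_2)}\le\mathsf{P}_{\mathsf{r}_2}\delta^{(\mathsf{p}_1,\mathsf{p}_2)}$.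 **Elementary doctrine (strict).** A functor $R:\mathscr{D}^{\mathrm{op}}\to\mathsf{InfSL}$, $\mathscr{D}$ with (strict) finite products, such that for every object $X$ there is $\delta_X\in R(X\times X)$ with (equivalently to the usual definition by left adjoints): $\top_X\le R_{\Delta_X}\delta_X$; $R_{p_1}\alpha\wedge\delta_X\le R_{p_2}\alpha$ for all $\alpha\in R(X)$; and $R_{\langle p_1,p_3\rangle}\delta_X\wedge R_{\langle p_2,p_4\rangle}\delta_Y\le\delta_{X\times Y}$ in $R(X\times Y\times X\times Y)$ for all $X,Y$. **Proof-irrelevant elements.** Let $\mathsf{P}$ be a biased elementary doctrine and $\mathsf{p}_i:W\to X_i$, $1\le i\le n$, a weak product. An element $\alpha\in\mathsf{P}(W)$ is proof-irrelevant if for some (equivalently, every) choice of weak products $W\xleftarrow{\mathsf{r}_1}U\xrightarrow{\mathsf{r}_2}W$, $X_i\xleftarrow{\mathsf{q}^i_1}W_i\xrightarrow{\mathsf{q}^i_2}X_i$ and arrows $t_i:U\to W_i$ with $\mathsf{q}^i_jt_i=\mathsf{p}_i\mathsf{r}_j$ ($j=1,2$) one has $\mathsf{P}_{\mathsf{r}_1}\alpha\wedge\bigwedge_{i}\mathsf{P}_{t_i}\delta^{(\mathsf{q}^i_1,\mathsf{q}^i_2)}\le\mathsf{P}_{\mathsf{r}_2}\alpha$. **Product completion.** $\mathscr{C}_s$ has as objects finite lists $[X_1,\dots,X_n]$ of objects of $\mathscr{C}$; an arrow $[X_1,\dots,X_n]\to[Y_1,\dots,Y_m]$ is a pair $(f,s)$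 with $s:\{1,\dots,m\}\to\{1,\dots,n\}$ a function and $f=[f_1,\dots,f_m]$, $f_j:X_{s(j)}\to Y_j$; composition is the evident one. Finite products are list concatenation. $S:\mathscr{C}\to\mathscr{C}_s$ sends $X$ to $[X]$ and $f$ to $([f],\mathrm{id}_{\{1\}})$. $R\circ S$ means $R\circ S^{\mathrm{op}}$. **Strictification.** For a non-empty list, $\mathsf{P}^{s}[X_1,\dots,X_n]$ is the inf-semilattice of proof-irrelevant elements of weak products of $X_1,\dots,X_n$, where those of different weak products $W,W'$ are identified via the isomorphisms given by reindexing $\mathsf{P}_h$ along any $h:W\to W'$ commuting with the projections (the result does not depend on $h$). $\mathsf{P}^{s}([\ ])$ is a singleton $\{*\}$, and reindexing along $[X_1,\dots,X_n]\to[\ ]$ sends $*$ to the top. For $(f,s):[X_1,\dots,X_n]\to[Y_1,\dots,Y_m]$ with $m\geq 1$, $\mathsf{P}^{s}_{(f,s)}$ sends the class of $\alpha\in\mathsf{P}(V)$ (with $\mathsf{p}'_j:V\to Y_j$ a weak product) to the class of $\mathsf{P}_g\alpha$, for any weak product $\mathsf{p}_i:W\to X_i$ and any $g:W\to V$ with $\mathsf{p}'_jg=f_j\mathsf{p}_{s(j)}$. *)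

(* Defs.v *)
(* Inf-semilattices are the [tMeetSemilatticeType]s of the order library. Their
   boolean order and choice structure are no restriction: [boolp] puts them on
   every poset with finite meets. *)
From HB Require Import structures.
From mathcomp Require Import all_boot generic_quotient all_order.
From mathcomp Require Import boolp.

Set Implicit Arguments.
Unset Strict Implicit.
Unset Printing Implicit Defensive.

Import Order.TTheory.

Declare Scope cat_scope.
Delimit Scope cat_scope with cat.
Local Open Scope order_scope.
Local Open Scope cat_scope.

Record category := Category {
  cat_ob :> Type;
  Hom : cat_ob -> cat_ob -> Type;
  idc : forall X, Hom X X;
  compc : forall X Y Z, Hom Y Z -> Hom X Y -> Hom X Z;
  comp1c : forall X Y (f : Hom X Y), compc (idc Y) f = f;
  compc1 : forall X Y (f : Hom X Y), compc f (idc X) = f;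
  compA : forall X Y Z T (h : Hom Z T) (g : Hom Y Z) (f : Hom X Y),
    compc h (compc g f) = compc (compc h g) f
}.
Arguments Hom {c} X Y.
Arguments idc {c} X.
Arguments compc {c X Y Z} g f.
Notation "g \c f" := (compc g f) (at level 50, left associativity) : cat_scope.

Record functor (C D : category) := Functor {
  fun_ob :> C -> D;
  fun_hom : forall X Y : C, Hom X Y -> Hom (fun_ob X) (fun_ob Y);
  fun_id : forall X, fun_hom (idc X) = idc (fun_ob X);
  fun_comp : forall X Y Z (g : Hom Y Z) (f : Hom X Y),
    fun_hom (g \c f) = fun_hom g \c fun_hom f
}.

Definition ob_at (C : category) (X : seq C) (i : 'I_(size X)) : C :=
  tnth (in_tuple X) i.

Record weak_product (C : category) (X : seq C) := WeakProduct {
  wp_ob :> C;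
  wp_proj : forall i : 'I_(size X), Hom wp_ob (ob_at i);
  wp_lift : forall (Z : C) (f : forall i : 'I_(size X), Hom Z (ob_at i)),
    exists h : Hom Z wp_ob, forall i, wp_proj i \c h = f i
}.

Definition has_weak_products (C : category) : Prop :=
  forall X : seq C, inhabited (weak_product X).

Definition wp1 (C : category) (X Y : C) (W : weak_product [:: X; Y]) : Hom W X :=
  @wp_proj C [:: X; Y] W ord0.
Definition wp2 (C : category) (X Y : C) (W : weak_product [:: X; Y]) : Hom W Y :=
  @wp_proj C [:: X; Y] W (@Ordinal 2 1 isT).

Notation weak_square X := (weak_product [:: X; X]).

(* A functor C^op -> InfSL; monotonicity of [reindex] follows from [reindex_meet]. *)
Record doctrine (d : Order.disp_t) (C : category) := Doctrine {
  fib :> C -> tMeetSemilatticeType d;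
  reindex : forall X Y : C, Hom X Y -> fib Y -> fib X;
  reindex_top : forall X Y (f : Hom X Y), reindex f \top = \top;
  reindex_meet : forall X Y (f : Hom X Y), {morph reindex f : a b / a `&` b};
  reindex_id : forall X (a : fib X), reindex (idc X) a = a;
  reindex_comp : forall X Y Z (g : Hom Y Z) (f : Hom X Y) (a : fib Z),
    reindex (g \c f) a = reindex f (reindex g a)
}.
Arguments reindex {d C} P {X Y} f _ : rename.

Program Definition precomp d (C D : category) (R : doctrine d D)
    (F : functor C D) : doctrine d C :=
  {| fib := fun X => R (F X);
     reindex := fun X Y f => reindex R (fun_hom F f) |}.
Next Obligation. exact: reindex_top. Qed.
Next Obligation. exact: reindex_meet. Qed.
Next Obligation. by rewrite fun_id reindex_id. Qed.
Next Obligation. by rewrite fun_comp reindex_comp. Qed.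

Record biased_elementary d (C : category) (P : doctrine d C)
    (delta : forall (X : C) (W : weak_square X), P W) : Prop :=
  BiasedElementary {
  be_weak_products : has_weak_products C;
  be_refl : forall (X : C) (W : weak_square X) (h : Hom X W),
    wp1 W \c h = idc X -> wp2 W \c h = idc X ->
    \top <= reindex P h (delta X W);
  be_subst : forall (X : C) (W : weak_square X) (a : P X),
    reindex P (wp1 W) a `&` delta X W <= reindex P (wp2 W) a;
  be_natural : forall (X X' : C) (W : weak_square X) (W' : weak_square X')
      (f : Hom X' X) (g : Hom W' W),
    wp1 W \c g = f \c wp1 W' -> wp2 W \c g = f \c wp2 W' ->
    delta X' W' <= reindex P g (delta X W);
  be_compat : forall (X : C) (W : weak_square X)
      (U : weak_square (wp_ob W)) (t t' : Hom U W),
    wp1 W \c t = wp1 W \c wp1 U -> wp2 W \c t = wp1 W \c wp2 U ->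
    wp1 W \c t' = wp2 W \c wp1 U -> wp2 W \c t' = wp2 W \c wp2 U ->
    reindex P (wp1 U) (delta X W) `&` reindex P t (delta X W)
      `&` reindex P t' (delta X W) <= reindex P (wp2 U) (delta X W)
}.

Record finite_products (D : category) := FiniteProducts {
  fp_one : D;
  fp_bang : forall X : D, Hom X fp_one;
  fp_bang_uniq : forall (X : D) (f : Hom X fp_one), f = fp_bang X;
  fp_prod : D -> D -> D;
  fp_fst : forall X Y : D, Hom (fp_prod X Y) X;
  fp_snd : forall X Y : D, Hom (fp_prod X Y) Y;
  fp_pair : forall X Y Z : D, Hom Z X -> Hom Z Y -> Hom Z (fp_prod X Y);
  fp_pair_fst : forall X Y Z (f : Hom Z X) (g : Hom Z Y),
    fp_fst X Y \c fp_pair f g = f;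
  fp_pair_snd : forall X Y Z (f : Hom Z X) (g : Hom Z Y),
    fp_snd X Y \c fp_pair f g = g;
  fp_pair_uniq : forall X Y Z (h : Hom Z (fp_prod X Y)),
    fp_pair (fp_fst X Y \c h) (fp_snd X Y \c h) = h
}.
Arguments fp_prod {D} FP X Y : rename.
Arguments fp_fst {D} FP X Y : rename.
Arguments fp_snd {D} FP X Y : rename.
Arguments fp_pair {D} FP {X Y Z} f g : rename.

Definition diag (D : category) (FP : finite_products D) (X : D) :
    Hom X (fp_prod FP X X) :=
  fp_pair FP (idc X) (idc X).

(* In (X * Y) * (X * Y), these are <p1, p3> and <p2, p4>. *)
Definition pair13 (D : category) (FP : finite_products D) (X Y : D) :
    Hom (fp_prod FP (fp_prod FP X Y) (fp_prod FP X Y)) (fp_prod FP X X) :=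
  let XY := fp_prod FP X Y in
  fp_pair FP (fp_fst FP X Y \c fp_fst FP XY XY) (fp_fst FP X Y \c fp_snd FP XY XY).
Definition pair24 (D : category) (FP : finite_products D) (X Y : D) :
    Hom (fp_prod FP (fp_prod FP X Y) (fp_prod FP X Y)) (fp_prod FP Y Y) :=
  let XY := fp_prod FP X Y in
  fp_pair FP (fp_snd FP X Y \c fp_fst FP XY XY) (fp_snd FP X Y \c fp_snd FP XY XY).

Definition elementary d (D : category) (FP : finite_products D)
    (R : doctrine d D) : Prop :=
  exists delta : forall X : D, R (fp_prod FP X X),
  [/\ forall X, \top <= reindex R (diag FP X) (delta X),
      forall X (a : R X),
        reindex R (fp_fst FP X X) a `&` delta X <= reindex R (fp_snd FP X X) a
    & forall X Y,
        reindex R (pair13 FP X Y) (delta X) `&` reindex R (pair24 FP X Y) (delta Y)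
          <= delta (fp_prod FP X Y)].

Section ProductCompletion.
Variable C : category.

Record pc_hom (X Y : seq C) := PcHom {
  pc_idx : 'I_(size Y) -> 'I_(size X);
  pc_arr : forall j : 'I_(size Y), Hom (ob_at (pc_idx j)) (ob_at j)
}.

Definition pc_pack X Y (F : pc_hom X Y) (j : 'I_(size Y)) :
    {i : 'I_(size X) & Hom (ob_at i) (ob_at j)} :=
  existT _ (pc_idx F j) (pc_arr F j).

Definition pc_unpack X Y
    (u : forall j : 'I_(size Y), {i : 'I_(size X) & Hom (ob_at i) (ob_at j)}) :
    pc_hom X Y :=
  PcHom (fun j => projT2 (u j)).

Lemma pc_hom_ext X Y (F G : pc_hom X Y) :
  (forall j, pc_pack F j = pc_pack G j) -> F = G.
Proof.
move=> eqFG; have eFG := functional_extensionality_dep eqFG.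
have K (H : pc_hom X Y) : H = pc_unpack (pc_pack H) by case: H.
by rewrite (K F) eFG -K.
Qed.

Definition pc_id (X : seq C) : pc_hom X X :=
  @PcHom X X id (fun j => idc (ob_at j)).

Definition pc_comp (X Y Z : seq C) (G : pc_hom Y Z) (F : pc_hom X Y) : pc_hom X Z :=
  @PcHom X Z (pc_idx F \o pc_idx G)
    (fun k => pc_arr G k \c pc_arr F (pc_idx G k)).

Program Definition product_completion : category :=
  {| cat_ob := seq C; Hom := pc_hom; idc := pc_id; compc := pc_comp |}.
Next Obligation.
by apply: pc_hom_ext => j; rewrite /pc_pack /= comp1c.
Qed.
Next Obligation.
by apply: pc_hom_ext => j; rewrite /pc_pack /= compc1.
Qed.
Next Obligation.
by apply: pc_hom_ext => j; rewrite /pc_pack /= compA.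
Qed.

Definition ord1_fam (T : 'I_1 -> Type) (x : forall lt01, T (@Ordinal 1 0 lt01))
    (i : 'I_1) : T i :=
  let: Ordinal m lt_m1 := i in
  match m return forall lt_m1 : (m < 1)%N, T (Ordinal lt_m1) with
  | 0 => x
  | _.+1 => fun lt_m1 => match notF lt_m1 with end
  end lt_m1.

Program Definition pc_embed : functor C product_completion :=
  {| fun_ob := fun X => [:: X] : product_completion;
     fun_hom := fun X Y f =>
       @PcHom [:: X] [:: Y] id (ord1_fam (fun=> f)) |}.
Next Obligation.
by apply: pc_hom_ext => -[[|//] lt01].
Qed.
Next Obligation.
by apply: pc_hom_ext => -[[|//] lt01].
Qed.

Definition pc_bang (X : seq C) : pc_hom X [::] :=
  @PcHom X [::] (fun j => match notF (ltn_ord j) with end)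
    (fun j => match notF (ltn_ord j) with end).

Definition cat_inl (X Y : seq C) (i : 'I_(size X)) : 'I_(size (X ++ Y)) :=
  cast_ord (esym (size_cat X Y)) (lshift (size Y) i).
Definition cat_inr (X Y : seq C) (i : 'I_(size Y)) : 'I_(size (X ++ Y)) :=
  cast_ord (esym (size_cat X Y)) (rshift (size X) i).

Lemma ob_at_inl X Y (i : 'I_(size X)) : ob_at (cat_inl Y i) = ob_at i.
Proof.
rewrite /ob_at (tnth_nth (ob_at i)) (tnth_nth (ob_at i)) /=.
by rewrite nth_cat ltn_ord.
Qed.

Lemma ob_at_inr X Y (i : 'I_(size Y)) : ob_at (cat_inr X i) = ob_at i.
Proof.
rewrite /ob_at (tnth_nth (ob_at i)) (tnth_nth (ob_at i)) /=.
by rewrite nth_cat ltnNge leq_addr /= addKn.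
Qed.

Definition hom_of_eq (A B : C) (e : A = B) : Hom A B :=
  let: erefl := e in idc A.

Lemma hom_of_eqK (A B Z : C) (e : A = B) (f : Hom Z B) :
  hom_of_eq e \c (hom_of_eq (esym e) \c f) = f.
Proof. by case: _ / e f => f /=; rewrite !comp1c. Qed.

Lemma hom_of_eqVK (A B Z : C) (e : A = B) (f : Hom Z A) :
  hom_of_eq (esym e) \c (hom_of_eq e \c f) = f.
Proof. by case: _ / e => /=; rewrite !comp1c. Qed.

(* [ob_at (cat_inl Y i)] and [ob_at i] are equal but not convertible, hence the
   transported identities. *)
Definition pc_fst (X Y : seq C) : pc_hom (X ++ Y) X :=
  @PcHom (X ++ Y) X (@cat_inl X Y) (fun i => hom_of_eq (ob_at_inl Y i)).
Definition pc_snd (X Y : seq C) : pc_hom (X ++ Y) Y :=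
  @PcHom (X ++ Y) Y (@cat_inr X Y) (fun i => hom_of_eq (ob_at_inr X i)).

Definition cat_case (X Y : seq C) (i : 'I_(size (X ++ Y))) :
  {j : 'I_(size X) | cat_inl Y j = i} + {j : 'I_(size Y) | cat_inr X j = i}.
Proof.
case: (splitP (cast_ord (size_cat X Y) i)) => j ej; [left|right];
  by exists j; apply/val_inj; rewrite /= -ej.
Defined.

Definition pc_pair_at (X Y Z : seq C) (F : pc_hom Z X) (G : pc_hom Z Y)
    (i : 'I_(size (X ++ Y))) : {k : 'I_(size Z) & Hom (ob_at k) (ob_at i)} :=
  match cat_case i with
  | inl (exist j e) => let: erefl := e in
      existT _ (pc_idx F j) (hom_of_eq (esym (ob_at_inl Y j)) \c pc_arr F j)
  | inr (exist j e) => let: erefl := e in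
      existT _ (pc_idx G j) (hom_of_eq (esym (ob_at_inr X j)) \c pc_arr G j)
  end.

Definition pc_pair (X Y Z : seq C) (F : pc_hom Z X) (G : pc_hom Z Y) :
    pc_hom Z (X ++ Y) :=
  pc_unpack (pc_pair_at F G).

Lemma cat_inl_inj X Y : injective (@cat_inl X Y).
Proof. by move=> i j /(congr1 val) /= eij; apply: val_inj. Qed.

Lemma cat_inr_inj X Y : injective (@cat_inr X Y).
Proof. by move=> i j /(congr1 val) /= /addnI eij; apply: val_inj. Qed.

Lemma cat_inlr X Y i j : @cat_inl X Y i <> @cat_inr X Y j.
Proof.
by move=> /(congr1 val) /= eij; have := ltn_ord i; rewrite eij ltnNge leq_addr.
Qed.

Lemma pc_pair_inl (X Y Z : seq C) (F : pc_hom Z X) (G : pc_hom Z Y) j :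
  pc_pack (pc_pair F G) (cat_inl Y j) =
  existT _ (pc_idx F j) (hom_of_eq (esym (ob_at_inl Y j)) \c pc_arr F j).
Proof.
rewrite /pc_pack /= -sigT_eta /pc_pair_at.
case: (cat_case _) => -[i e]; last by case: (cat_inlr (esym e)).
by have ij := cat_inl_inj e; subst i; rewrite (eq_axiomK e).
Qed.

Lemma pc_pair_inr (X Y Z : seq C) (F : pc_hom Z X) (G : pc_hom Z Y) j :
  pc_pack (pc_pair F G) (cat_inr X j) =
  existT _ (pc_idx G j) (hom_of_eq (esym (ob_at_inr X j)) \c pc_arr G j).
Proof.
rewrite /pc_pack /= -sigT_eta /pc_pair_at.
case: (cat_case _) => -[i e]; first by case: (cat_inlr e).
by have ij := cat_inr_inj e; subst i; rewrite (eq_axiomK e).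
Qed.

Lemma pc_pack_comp (X Y Z : seq C) (G : pc_hom Y Z) (F : pc_hom X Y) k :
  pc_pack (pc_comp G F) k =
  existT _ (projT1 (pc_pack F (pc_idx G k)))
    (pc_arr G k \c projT2 (pc_pack F (pc_idx G k))).
Proof. by []. Qed.

Program Definition pc_products : finite_products product_completion :=
  {| fp_one := [::] : product_completion;
     fp_bang := pc_bang;
     fp_prod := fun X Y : product_completion => (X ++ Y : seq C);
     fp_fst := pc_fst; fp_snd := pc_snd; fp_pair := pc_pair |}.
Next Obligation. by apply: pc_hom_ext => -[]. Qed.
Next Obligation.
by apply: pc_hom_ext => j; rewrite pc_pack_comp pc_pair_inl /= hom_of_eqK.
Qed.
Next Obligation.
by apply: pc_hom_ext => j; rewrite pc_pack_comp pc_pair_inr /= hom_of_eqK.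
Qed.
Next Obligation.
apply: pc_hom_ext => i; case: (cat_case i) => -[j <-].
  by rewrite pc_pair_inl /= hom_of_eqVK.
by rewrite pc_pair_inr /= hom_of_eqVK.
Qed.

End ProductCompletion.

Section Strictification.
Variables (d : Order.disp_t) (C : category) (P : doctrine d C).
Variable delta : forall (X : C) (W : weak_square X), P W.

(* Existential in the choice of weak products and arrows; [proof_irrelevantP]
   and [proof_irrelevant_intro] below show that every choice is equivalent. *)
Definition proof_irrelevant (X : seq C) (W : weak_product X) (a : P W) : Prop :=
  exists (U : weak_square (wp_ob W))
         (Q : forall i : 'I_(size X), weak_square (ob_at i))
         (t : forall i, Hom U (Q i)),
  [/\ forall i, wp1 (Q i) \c t i = wp_proj W i \c wp1 U,
      forall i, wp2 (Q i) \c t i = wp_proj W i \c wp2 U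
    & reindex P (wp1 U) a
        `&` \meet_(i < size X) reindex P (t i) (delta (Q i))
        <= reindex P (wp2 U) a].

Record pi_element (X : seq C) := PiElement {
  pi_wp : weak_product X;
  pi_val : P pi_wp;
  pi_irr : proof_irrelevant pi_val
}.

Definition wp_mor (X : seq C) (W V : weak_product X) (h : Hom W V) : Prop :=
  forall i, wp_proj V i \c h = wp_proj W i.

Definition pi_le (X : seq C) (a b : pi_element X) : Prop :=
  exists2 h : Hom (pi_wp a) (pi_wp b),
    wp_mor h & pi_val a <= reindex P h (pi_val b).

(* Any other choice of h gives the same reindexing, see [reindex_indep]. *)
Definition pi_eqv (X : seq C) (a b : pi_element X) : Prop :=
  exists2 h : Hom (pi_wp a) (pi_wp b),
    wp_mor h & pi_val a = reindex P h (pi_val b).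

Definition pc_over (X Y : seq C) (F : pc_hom X Y)
    (W : weak_product X) (V : weak_product Y) (g : Hom W V) : Prop :=
  forall j, wp_proj V j \c g = pc_arr F j \c wp_proj W (pc_idx F j).

Hypothesis Pbe : biased_elementary delta.

Lemma wp_exists (X : seq C) : inhabited (weak_product X).
Proof. exact: (be_weak_products Pbe). Qed.

Definition some_wp (X : seq C) : weak_product X :=
  sval (cid (let: inhabits W := wp_exists X in ex_intro (fun=> True) W I)).

Lemma reindex_le (X Y : C) (f : Hom X Y) (a b : P Y) :
  a <= b -> reindex P f a <= reindex P f b.
Proof. by rewrite !leEmeet -reindex_meet => /eqP->. Qed.

Lemma reindex_meets (X Y : C) (f : Hom X Y) n (F : 'I_n -> P Y) :
  reindex P f (\meet_(i < n) F i) = \meet_(i < n) reindex P f (F i).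
Proof. exact: (big_morph _ (@reindex_meet _ _ P _ _ f) (@reindex_top _ _ P _ _ f)). Qed.

Lemma wp_pair (X Y Z : C) (W : weak_product [:: X; Y]) (f : Hom Z X) (g : Hom Z Y) :
  exists2 h : Hom Z W, wp1 W \c h = f & wp2 W \c h = g.
Proof.
pose F (i : 'I_2) : Hom Z (@ob_at C [:: X; Y] i) :=
  let: Ordinal m lt_m2 := i in
  match m return forall lt_m2 : (m < 2)%N,
      Hom Z (@ob_at C [:: X; Y] (Ordinal lt_m2)) with
  | 0 => fun=> f
  | 1 => fun=> g
  | _.+2 => fun lt_m2 => match notF lt_m2 with end
  end lt_m2.
have [h hP] := wp_lift W F.
by exists h; [exact: (hP ord0) | exact: (hP (@Ordinal 2 1 isT))].
Qed.

(* An arrow whose two components agree reindexes delta to the top. *)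
Lemma delta_refl (X Z : C) (W : weak_square X) (t : Hom Z W) :
  wp1 W \c t = wp2 W \c t -> \top <= reindex P t (delta W).
Proof.
set e := wp1 W \c t => et2.
have [U] := wp_exists [:: wp_ob W; wp_ob W].
have [V] := wp_exists [:: Z; Z].
have [dX dX1 dX2] := wp_pair W (idc X) (idc X).
have [dZ dZ1 dZ2] := wp_pair V (idc Z) (idc Z).
have [K K1 K2] := wp_pair U (dX \c e \c wp1 V) (t \c wp2 V).
have [s s1 s2] := wp_pair W (wp1 W \c wp1 U) (wp1 W \c wp2 U).
have [s' s1' s2'] := wp_pair W (wp2 W \c wp1 U) (wp2 W \c wp2 U).
have top_over (g : Hom V W) : wp1 W \c g = e \c wp1 V -> wp2 W \c g = e \c wp2 V ->
    \top <= reindex P (g \c dZ) (delta W).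
  move=> g1 g2; rewrite reindex_comp.
  apply: le_trans (be_refl Pbe dZ1 dZ2) _.
  exact/reindex_le/(be_natural Pbe g1 g2).
have sK : \top <= reindex P (s \c (K \c dZ)) (delta W).
  rewrite compA; apply: top_over; rewrite compA ?s1 ?s2 -compA ?K1 ?K2 !compA.
    by rewrite dX1 comp1c.
  by [].
have sK' : \top <= reindex P (s' \c (K \c dZ)) (delta W).
  rewrite compA; apply: top_over; rewrite compA ?s1' ?s2' -compA ?K1 ?K2 !compA.
    by rewrite dX2 comp1c.
  by rewrite -et2.
have r1K : \top <= reindex P (wp1 U \c (K \c dZ)) (delta W).
  rewrite compA K1 -compA dZ1 compc1 reindex_comp.
  by rewrite -(reindex_top P e); apply/reindex_le/(be_refl Pbe).
have := reindex_le (K \c dZ) (be_compat Pbe s1 s2 s1' s2').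
rewrite !reindex_meet -!reindex_comp.
have -> : wp2 U \c (K \c dZ) = t by rewrite compA K2 -compA dZ2 compc1.
by apply: le_trans; rewrite !lexI r1K sK sK'.
Qed.

Lemma delta_indep (X Z : C) (W : weak_square X) (u v : Hom Z W) :
  wp1 W \c v = wp1 W \c u -> wp2 W \c v = wp2 W \c u ->
  reindex P u (delta W) <= reindex P v (delta W).
Proof.
move=> e1 e2; have [U] := wp_exists [:: wp_ob W; wp_ob W].
have [k k1 k2] := wp_pair U u v.
have [s s1 s2] := wp_pair W (wp1 W \c wp1 U) (wp1 W \c wp2 U).
have [s' s1' s2'] := wp_pair W (wp2 W \c wp1 U) (wp2 W \c wp2 U).
have := reindex_le k (be_compat Pbe s1 s2 s1' s2').
rewrite !reindex_meet -!reindex_comp k1 k2; apply: le_trans; rewrite !lexI lexx /=.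
apply/andP; split; apply/(le_trans (lex1 _))/delta_refl; rewrite !compA.
  by rewrite s1 s2 -!compA k1 k2 e1.
by rewrite s1' s2' -!compA k1 k2 e2.
Qed.

Lemma delta_map (X Y Z : C) (f : Hom X Y) (Q : weak_square X) (R : weak_square Y)
    (u : Hom Z Q) (v : Hom Z R) :
  wp1 R \c v = f \c (wp1 Q \c u) -> wp2 R \c v = f \c (wp2 Q \c u) ->
  reindex P u (delta Q) <= reindex P v (delta R).
Proof.
move=> e1 e2; have [g g1 g2] := wp_pair R (f \c wp1 Q) (f \c wp2 Q).
apply: le_trans (reindex_le u (be_natural Pbe g1 g2)) _.
rewrite -reindex_comp; apply: delta_indep; rewrite compA.
  by rewrite g1 e1 compA.
by rewrite g2 e2 compA.
Qed.

Lemma proof_irrelevantP (X : seq C) (W : weak_product X) (a : P W) :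
  proof_irrelevant a ->
  forall (Z : C) (f g : Hom Z W) (Q : forall i : 'I_(size X), weak_square (ob_at i))
    (t : forall i, Hom Z (Q i)),
  (forall i, wp1 (Q i) \c t i = wp_proj W i \c f) ->
  (forall i, wp2 (Q i) \c t i = wp_proj W i \c g) ->
  reindex P f a `&` \meet_(i < size X) reindex P (t i) (delta (Q i))
    <= reindex P g a.
Proof.
move=> [U [Q0 [t0 [t1 t2 irr]]]] Z f g Q t tf tg.
have [k kf kg] := wp_pair U f g.
have := reindex_le k irr; rewrite reindex_meet reindex_meets -!reindex_comp kf kg.
apply/le_trans; rewrite lexI leIl /=; apply/leIxr/meetsP => i _.
apply: meets_max => //; rewrite -reindex_comp.
apply: (@delta_map _ _ _ (idc _)); rewrite comp1c compA.
  by rewrite t1 -compA kf tf.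
by rewrite t2 -compA kg tg.
Qed.

Lemma proof_irrelevant_intro (X : seq C) (W : weak_product X) (a : P W) :
  (forall (U : weak_square (wp_ob W))
    (Q : forall i : 'I_(size X), weak_square (ob_at i)) (t : forall i, Hom U (Q i)),
    (forall i, wp1 (Q i) \c t i = wp_proj W i \c wp1 U) ->
    (forall i, wp2 (Q i) \c t i = wp_proj W i \c wp2 U) ->
    reindex P (wp1 U) a `&` \meet_(i < size X) reindex P (t i) (delta (Q i))
      <= reindex P (wp2 U) a) ->
  proof_irrelevant a.
Proof.
move=> irr; have [U] := wp_exists [:: wp_ob W; wp_ob W].
pose Q i : weak_square (@ob_at C X i) := some_wp _.
have t i : {t : Hom U (Q i) | wp1 (Q i) \c t = wp_proj W i \c wp1 U
                            & wp2 (Q i) \c t = wp_proj W i \c wp2 U}.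
  exact/cid2/wp_pair.
by exists U, Q, (fun i => s2val (t i)); split=> [i|i|]; last apply: irr => i;
  case: (t i).
Qed.

Lemma reindex_indep (X : seq C) (Z : C) (W : weak_product X) (a : P W)
    (f g : Hom Z W) :
  proof_irrelevant a -> (forall i, wp_proj W i \c f = wp_proj W i \c g) ->
  reindex P f a = reindex P g a.
Proof.
move=> irr.
suff le_fg (u v : Hom Z W) : (forall i, wp_proj W i \c u = wp_proj W i \c v) ->
    reindex P u a <= reindex P v a.
  by move=> efg; apply: le_anti; rewrite !le_fg.
move=> euv; pose Q i : weak_square (@ob_at C X i) := some_wp _.
have t i : {t : Hom Z (Q i) | wp1 (Q i) \c t = wp_proj W i \c u
                            & wp2 (Q i) \c t = wp_proj W i \c v}.
  exact/cid2/wp_pair.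
have := proof_irrelevantP irr (f := u) (g := v) (t := fun i => s2val (t i)).
move=> /(_ (fun i => s2valP (t i)) (fun i => s2valP' (t i))).
apply: le_trans; rewrite lexI lexx /=; apply/meetsP => i _.
apply: le_trans (lex1 _) (delta_refl _).
by case: (t i) => /= ti -> ->.
Qed.

Lemma irr_reindex (X Y : seq C) (F : pc_hom X Y) (W : weak_product X)
    (V : weak_product Y) (g : Hom W V) (a : P V) :
  pc_over F g -> proof_irrelevant a -> proof_irrelevant (reindex P g a).
Proof.
move=> gF irr; apply: proof_irrelevant_intro => U Q t t1 t2.
pose R j : weak_square (@ob_at C Y j) := some_wp _.
have v j : {v : Hom U (R j) | wp1 (R j) \c v = wp_proj V j \c (g \c wp1 U)
                            & wp2 (R j) \c v = wp_proj V j \c (g \c wp2 U)}.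
  exact/cid2/wp_pair.
have := proof_irrelevantP irr (t := fun j => s2val (v j))
  (fun j => s2valP (v j)) (fun j => s2valP' (v j)).
rewrite !reindex_comp; apply: le_trans; rewrite lexI leIl /=.
apply/leIxr/meetsP => j _; apply: (@meets_max _ _ _ (pc_idx F j)) => //.
case: (v j) => /= vj v1 v2; apply: (@delta_map _ _ _ (pc_arr F j)).
  by rewrite v1 t1 !compA gF.
by rewrite v2 t2 !compA gF.
Qed.

Lemma irr_top (X : seq C) (W : weak_product X) : @proof_irrelevant X W \top.
Proof.
by apply: proof_irrelevant_intro => U Q t _ _; rewrite !reindex_top lex1.
Qed.

Lemma irr_meet (X : seq C) (W : weak_product X) (a b : P W) :
  proof_irrelevant a -> proof_irrelevant b -> proof_irrelevant (a `&` b).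
Proof.
move=> irra irrb; apply: proof_irrelevant_intro => U Q t t1 t2.
rewrite !reindex_meet lexI; apply/andP; split.
  by apply: le_trans (proof_irrelevantP irra t1 t2); rewrite leI2 ?leIl.
by apply: le_trans (proof_irrelevantP irrb t1 t2); rewrite leI2 ?leIr.
Qed.

Lemma wp_mor_over (X : seq C) (W V : weak_product X) (h : Hom W V) :
  wp_mor h <-> pc_over (pc_id X) h.
Proof. by split=> hP i; rewrite hP /= comp1c. Qed.

Lemma over_exists (X Y : seq C) (F : pc_hom X Y) (W : weak_product X)
    (V : weak_product Y) : exists g : Hom W V, pc_over F g.
Proof. exact: wp_lift. Qed.

Lemma wp_mor_exists (X : seq C) (W V : weak_product X) :
  exists h : Hom W V, wp_mor h.
Proof. exact: wp_lift. Qed.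

Lemma pi_leP (X : seq C) (a b : pi_element X) (h : Hom (pi_wp a) (pi_wp b)) :
  wp_mor h -> pi_le a b <-> pi_val a <= reindex P h (pi_val b).
Proof.
move=> hP; split=> [[k kP]|]; last by exists h.
by rewrite (reindex_indep (g := h) (pi_irr b)) // => i; rewrite hP kP.
Qed.

Lemma pi_le_refl (X : seq C) (a : pi_element X) : pi_le a a.
Proof.
by exists (idc _); [move=> i; rewrite compc1 | rewrite reindex_id].
Qed.

Lemma pi_le_trans (X : seq C) (b a c : pi_element X) :
  pi_le a b -> pi_le b c -> pi_le a c.
Proof.
move=> [h hP ab] [k kP bc]; exists (k \c h).
  by move=> i; rewrite compA kP hP.
by rewrite reindex_comp; apply/(le_trans ab)/reindex_le.
Qed.

Lemma pi_eqvE (X : seq C) (a b : pi_element X) :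
  pi_eqv a b <-> pi_le a b /\ pi_le b a.
Proof.
have [h hP] := wp_mor_exists (pi_wp a) (pi_wp b).
have [k kP] := wp_mor_exists (pi_wp b) (pi_wp a).
have hkP : reindex P k (reindex P h (pi_val b)) = pi_val b.
  rewrite -reindex_comp -[RHS](reindex_id (d := d)).
  by apply: (reindex_indep (pi_irr b)) => i; rewrite compA hP kP compc1.
split=> [[l lP ab]|[/(pi_leP hP) ab /(pi_leP kP) ba]].
  split; first by exists l; rewrite ?ab.
  exists k => //; rewrite ab (reindex_indep (g := h) (pi_irr b)) ?hkP // => i.
  by rewrite lP hP.
exists h => //; apply: le_anti; rewrite ab /=.
have /(reindex_le h) := ba; rewrite -reindex_comp.
rewrite (reindex_indep (g := idc _) (pi_irr a)) ?reindex_id // => i.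
by rewrite compA kP hP compc1.
Qed.

Definition pi_eqvb (X : seq C) : rel (pi_element X) := fun a b => `[< pi_eqv a b >].

Lemma pi_eqvb_refl X : reflexive (@pi_eqvb X).
Proof. by move=> a; apply/asboolP/pi_eqvE; split; apply: pi_le_refl. Qed.

Lemma pi_eqvb_sym X : symmetric (@pi_eqvb X).
Proof.
by move=> a b; apply/asboolP/asboolP => /pi_eqvE[? ?]; apply/pi_eqvE.
Qed.

Lemma pi_eqvb_trans X : transitive (@pi_eqvb X).
Proof.
move=> b a c /asboolP/pi_eqvE[ab ba] /asboolP/pi_eqvE[bc cb].
by apply/asboolP/pi_eqvE; split; apply: (@pi_le_trans _ b).
Qed.

HB.instance Definition _ X := gen_eqMixin (pi_element X).
HB.instance Definition _ X := gen_choiceMixin (pi_element X).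

Canonical pi_equiv_rel X :=
  EquivRel (@pi_eqvb X) (@pi_eqvb_refl X) (@pi_eqvb_sym X) (@pi_eqvb_trans X).

Definition pi_class (X : seq C) := {eq_quot (pi_equiv_rel X)}%qT.
HB.instance Definition _ X := Choice.on (pi_class X).

Definition cls (X : seq C) (a : pi_element X) : pi_class X := (\pi a)%qT.

Lemma clsP X (a b : pi_element X) : cls a = cls b <-> pi_eqv a b.
Proof. by split=> [/eqmodP/asboolP|ab]; last exact/eqmodP/asboolP. Qed.

Lemma cls_repr X (x : pi_class X) : cls (repr x) = x.
Proof. exact: reprK. Qed.

Lemma repr_cls X (a : pi_element X) : pi_eqv (repr (cls a)) a.
Proof. exact/clsP/cls_repr. Qed.

Definition cls_le (X : seq C) : rel (pi_class X) :=
  fun x y => `[< pi_le (repr x) (repr y) >].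

Definition pi_top (X : seq C) : pi_element X := PiElement (irr_top (some_wp X)).

Definition pi_meet (X : seq C) (a b : pi_element X) : pi_element X :=
  let h := cid (wp_mor_exists (pi_wp a) (pi_wp b)) in
  PiElement (irr_meet (pi_irr a)
    (irr_reindex ((wp_mor_over _).1 (svalP h)) (pi_irr b))).

Definition pi_reindex (X Y : seq C) (F : pc_hom X Y) (b : pi_element Y)
    (W : weak_product X) (g : Hom W (pi_wp b)) (gF : pc_over F g) :
    pi_element X :=
  PiElement (irr_reindex gF (pi_irr b)).

Lemma cls_leP X (a b : pi_element X) : cls_le (cls a) (cls b) <-> pi_le a b.
Proof.
have /pi_eqvE[ra ar] := repr_cls a; have /pi_eqvE[rb br] := repr_cls b.
split=> [/asboolP ab|ab]; last apply/asboolP.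
  exact/(pi_le_trans ar)/(pi_le_trans ab).
exact/(pi_le_trans ra)/(pi_le_trans ab).
Qed.

Lemma clsW X (T : pi_class X -> Prop) : (forall a, T (cls a)) -> forall x, T x.
Proof. by move=> Ta x; rewrite -(cls_repr x). Qed.

Lemma cls_le_refl X : reflexive (@cls_le X).
Proof. by elim/clsW => a; apply/cls_leP/pi_le_refl. Qed.

Lemma cls_le_anti X : antisymmetric (@cls_le X).
Proof.
elim/clsW => a; elim/clsW => b /andP[/cls_leP ab /cls_leP ba].
exact/clsP/pi_eqvE.
Qed.

Lemma cls_le_trans X : transitive (@cls_le X).
Proof.
elim/clsW => b; elim/clsW => a; elim/clsW => c /cls_leP ab /cls_leP bc.
exact/cls_leP/(pi_le_trans ab).
Qed.

HB.instance Definition _ X := Order.Le_isPOrder.Build d (pi_class X)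
  (@cls_le_refl X) (@cls_le_anti X) (@cls_le_trans X).

Lemma cls_leE X (a b : pi_element X) : (cls a <= cls b) <-> pi_le a b.
Proof. exact: cls_leP. Qed.

Definition cls_meet X (x y : pi_class X) : pi_class X :=
  cls (pi_meet (repr x) (repr y)).

Lemma cls_lexI X (x y z : pi_class X) :
  (x <= cls_meet y z) = (x <= y) && (x <= z).
Proof.
rewrite -(cls_repr x) -[in RHS](cls_repr y) -[in RHS](cls_repr z) /cls_meet.
move: (repr x) (repr y) (repr z) => {x y z} a b c.
rewrite /pi_meet; case: (cid _) => h hP /=.
have [k kP] := wp_mor_exists (pi_wp a) (pi_wp b).
have hkP : wp_mor (h \c k) by move=> i; rewrite compA hP kP.
apply/idP/andP => [/cls_leE|[/cls_leE ab /cls_leE ac]].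
  move=> /(pi_leP (b := PiElement _) kP) /=.
  rewrite reindex_meet lexI -reindex_comp => /andP[ab ac].
  by split; apply/cls_leE; [exists k|exists (h \c k)].
apply/cls_leE; exists k => //=; rewrite reindex_meet lexI -reindex_comp.
by rewrite (pi_leP kP).1 ?(pi_leP hkP).1.
Qed.

HB.instance Definition _ X :=
  Order.POrder_isMeetSemilattice.Build d (pi_class X) (@cls_lexI X).

Lemma cls_lex1 X (x : pi_class X) : x <= cls (pi_top X).
Proof.
elim/clsW: x => a; apply/cls_leE.
by have [h hP] := wp_mor_exists (pi_wp a) (some_wp X); exists h; rewrite ?reindex_top.
Qed.

HB.instance Definition _ X :=
  Order.hasTop.Build d (pi_class X) (@cls_lex1 X).

Definition cls_reindex (X Y : seq C) (F : pc_hom X Y) (y : pi_class Y) :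
    pi_class X :=
  let W := some_wp X in
  let g := cid (over_exists F W (pi_wp (repr y))) in
  cls (pi_reindex (svalP g)).

(* The class of (V, a) goes to that of (W, P_g a), for any W and g over F. *)
Lemma cls_reindexE (X Y : seq C) (F : pc_hom X Y) (b : pi_element Y)
    (W : weak_product X) (g : Hom W (pi_wp b)) (gF : pc_over F g) :
  cls_reindex F (cls b) = cls (pi_reindex gF).
Proof.
rewrite /cls_reindex; case: (cid _) => g' gF' /=.
have [h hP er] := repr_cls b.
have [k kP] := wp_mor_exists (some_wp X) W.
apply/clsP; exists k => //=; rewrite er -!reindex_comp.
apply: (reindex_indep (pi_irr b)) => j.
by rewrite !compA hP gF' gF -compA kP.
Qed.

Lemma cls_reindex_top (X Y : seq C) (F : pc_hom X Y) :
  cls_reindex F \top = \top.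
Proof.
have [g gF] := over_exists F (some_wp X) (pi_wp (pi_top Y)).
rewrite [LHS](cls_reindexE gF); apply/clsP; exists (idc _).
  by move=> i; rewrite compc1.
by rewrite /= !reindex_top.
Qed.

Lemma cls_meetE X (W : weak_product X) (a b : P W)
    (irra : proof_irrelevant a) (irrb : proof_irrelevant b) :
  cls (PiElement irra) `&` cls (PiElement irrb) = cls (PiElement (irr_meet irra irrb)).
Proof.
apply: le_anti; rewrite lexI; apply/and3P; split.
- move: (leIl (cls (PiElement irra)) (cls (PiElement irrb))).
  move: (leIr (cls (PiElement irrb)) (cls (PiElement irra))).
  move: (cls _ `&` cls _) => x; elim/clsW: x => c; have [k kP] := wp_mor_exists (pi_wp c) W.
  move=> /cls_leE/(pi_leP (b := PiElement _) kP) /= cb.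
  move=> /cls_leE/(pi_leP (b := PiElement _) kP) /= ca.
  by apply/cls_leE; exists k => //=; rewrite reindex_meet lexI ca cb.
- apply/cls_leE; exists (idc _); first by move=> i; rewrite compc1.
  by rewrite /= reindex_id leIl.
- apply/cls_leE; exists (idc _); first by move=> i; rewrite compc1.
  by rewrite /= reindex_id leIr.
Qed.

Lemma clsW2 X (T : pi_class X -> pi_class X -> Prop) :
  (forall (W : weak_product X) (a b : P W)
    (irra : proof_irrelevant a) (irrb : proof_irrelevant b),
    T (cls (PiElement irra)) (cls (PiElement irrb))) ->
  forall x y, T x y.
Proof.
move=> TW; elim/clsW => -[W a irra]; elim/clsW => b.
have [h hP] := wp_mor_exists W (pi_wp b).
suff -> : cls b = cls (PiElement (irr_reindex ((wp_mor_over h).1 hP) (pi_irr b))).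
  exact: TW.
by apply/esym/clsP; exists h.
Qed.

Lemma cls_reindex_meet (X Y : seq C) (F : pc_hom X Y) :
  {morph cls_reindex F : x y / x `&` y}.
Proof.
apply: clsW2 => V a b irra irrb; rewrite cls_meetE.
have [g gF] := over_exists F (some_wp X) V.
rewrite !(cls_reindexE (b := PiElement _) gF) /pi_reindex /= cls_meetE.
apply/clsP; exists (idc _); first by move=> i; rewrite compc1.
by rewrite /= reindex_id reindex_meet.
Qed.

Lemma cls_reindex_id (X : seq C) (x : pi_class X) :
  cls_reindex (pc_id X) x = x.
Proof.
elim/clsW: x => a.
have iP : wp_mor (idc (pi_wp a)) by move=> i; rewrite compc1.
rewrite (cls_reindexE ((wp_mor_over _).1 iP)); apply/clsP.
by exists (idc _).
Qed.

Lemma cls_reindex_comp (X Y Z : seq C) (G : pc_hom Y Z) (F : pc_hom X Y)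
    (z : pi_class Z) :
  cls_reindex (pc_comp G F) z = cls_reindex F (cls_reindex G z).
Proof.
elim/clsW: z => c.
have [g gG] := over_exists G (some_wp Y) (pi_wp c).
have [f fF] := over_exists F (some_wp X) (some_wp Y).
have gfP : pc_over (pc_comp G F) (g \c f).
  by move=> k; rewrite compA gG -compA fF compA.
rewrite (cls_reindexE gfP) (cls_reindexE gG).
rewrite (cls_reindexE (b := pi_reindex gG) fF).
apply/clsP; exists (idc _); first by move=> i; rewrite compc1.
by rewrite /= reindex_id reindex_comp.
Qed.

End Strictification.

Definition singleton_fib := unit.
HB.instance Definition _ := Choice.on singleton_fib.

Section Point.
Variable d : Order.disp_t.

Fact singleton_fib_refl : reflexive (fun _ _ : singleton_fib => true). Proof. by []. Qed.
Fact singleton_fib_anti : antisymmetric (fun _ _ : singleton_fib => true).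
Proof. by case=> -[]. Qed.
Fact singleton_fib_trans : transitive (fun _ _ : singleton_fib => true). Proof. by []. Qed.

HB.instance Definition _ :=
  Order.Le_isPOrder.Build d singleton_fib singleton_fib_refl singleton_fib_anti singleton_fib_trans.

Fact singleton_fib_lexI (x y z : singleton_fib) : (x <= tt) = (x <= y) && (x <= z).
Proof. by []. Qed.
Fact singleton_fib_lex1 (x : singleton_fib) : x <= (tt : singleton_fib). Proof. by []. Qed.

HB.instance Definition _ :=
  @Order.POrder_isMeetSemilattice.Build d singleton_fib (fun _ _ => tt) singleton_fib_lexI.
HB.instance Definition _ := @Order.hasTop.Build d singleton_fib tt singleton_fib_lex1.
End Point.


Section StrictDoctrine.
Variables (d : Order.disp_t) (C : category) (P : doctrine d C).
Variables (delta : forall (X : C) (W : weak_square X), P W).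
Hypothesis Pbe : biased_elementary delta.

Definition strict_fib (X : seq C) : tMeetSemilatticeType d :=
  if X is [::] then singleton_fib else pi_class Pbe X.

(* There is no arrow from the empty list to a non-empty one. *)
Definition strict_reindex (X Y : seq C) :
    pc_hom X Y -> strict_fib Y -> strict_fib X :=
  match Y, X with
  | [::], _ => fun _ _ => \top
  | _ :: _, [::] => fun _ _ => \top
  | _ :: _, _ :: _ => fun F y => cls_reindex F y
  end.

Fact strict_reindex_top X Y (F : pc_hom X Y) : strict_reindex F \top = \top.
Proof. by case: Y X F => [|? ?] [|? ?] F //; apply: cls_reindex_top. Qed.

Fact strict_reindex_meet X Y (F : pc_hom X Y) :
  {morph strict_reindex F : x y / x `&` y}.
Proof.
case: Y X F => [|? ?] [|? ?] F //; last exact: cls_reindex_meet.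
by move=> x y; rewrite /= meetxx.
Qed.

Fact strict_reindex_id X (x : strict_fib X) : strict_reindex (pc_id X) x = x.
Proof. by case: X x => [[]//|? ?] x; apply: cls_reindex_id. Qed.

Fact strict_reindex_comp X Y Z (G : pc_hom Y Z) (F : pc_hom X Y)
    (z : strict_fib Z) :
  strict_reindex (pc_comp G F) z = strict_reindex F (strict_reindex G z).
Proof.
case: Z Y X G F z => [|? ?] [|? ?] [|? ?] G F z //=.
- by rewrite cls_reindex_top.
- by case: (pc_idx G ord0).
- exact: cls_reindex_comp.
Qed.

Definition strictification : doctrine d (product_completion C) :=
  @Doctrine d (product_completion C) strict_fib strict_reindex
    strict_reindex_top strict_reindex_meet strict_reindex_id strict_reindex_comp.

End StrictDoctrine.

(* Main.v *)
(* Both doctrines are handled through the element of the fibre over Z that says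
   "f = g", for parallel arrows f and g out of Z.

   If P is biased elementary, this element of P Z is the reindexing of any delta
   along an arrow with components f and g. Proof-irrelevance of an element over
   a weak product of X_1, ..., X_n is then substitutivity for tuples of such
   equalities. For F, G : X -> Y in the product completion, the conjunction of
   the equalities of their components is proof-irrelevant, and the equality
   predicate of Y is the one of the two projections of Y x Y.

   Conversely, in a strict elementary doctrine, compatibility with products
   makes equality a congruence, and the delta of a weak product (p1, p2) is
   "S p1 = S p2". *)
From mathcomp Require Import all_boot all_order.
From mathcomp Require Import boolp.
Require Import Defs.

Set Implicit Arguments.
Unset Strict Implicit.
Unset Printing Implicit Defensive.

Import Order.TTheory.
Local Open Scope order_scope.
Local Open Scope cat_scope.

(** * Equality predicates in a biased elementary doctrine and its strictification *)

Section BiasedEquality.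
Variables (d : Order.disp_t) (C : category) (P : doctrine d C).
Variable delta : forall (X : C) (W : weak_square X), P W.
Hypothesis Pbe : biased_elementary delta.

Lemma beq_arrow_ex (Z X : C) (f g : Hom Z X) :
  exists h : Hom Z (some_wp Pbe [:: X; X]), wp1 _ \c h = f /\ wp2 _ \c h = g.
Proof. by have [h h1 h2] := wp_pair (some_wp Pbe [:: X; X]) f g; exists h. Qed.

Definition beq (Z X : C) (f g : Hom Z X) : P Z :=
  reindex P (sval (cid (beq_arrow_ex f g))) (delta _).

(** Naturality of [delta] over the identity of [X], used in both directions, shows that neither the
    weak square nor the arrow matters, only the two components. *)
Lemma beqE (Z X : C) (W : weak_square X) (h : Hom Z W) :
  reindex P h (delta W) = beq (wp1 W \c h) (wp2 W \c h).
Proof.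
rewrite /beq; case: (cid _) => k [k1 k2] /=; apply: le_anti.
by apply/andP; split; apply: (delta_map Pbe (f := idc X)); rewrite comp1c.
Qed.

Lemma reindex_beq (Y Z X : C) (k : Hom Y Z) (f g : Hom Z X) :
  reindex P k (beq f g) = beq (f \c k) (g \c k).
Proof.
rewrite {1}/beq; case: (cid _) => h [h1 h2] /=.
by rewrite -reindex_comp beqE !compA h1 h2.
Qed.

Lemma beq_refl (Z X : C) (f : Hom Z X) : beq f f = \top.
Proof.
apply/le_anti; rewrite lex1 /= /beq; case: (cid _) => h [h1 h2] /=.
by apply: (delta_refl Pbe); rewrite h1 h2.
Qed.

Lemma beq_map (Z X Y : C) (h : Hom X Y) (f g : Hom Z X) :
  beq f g <= beq (h \c f) (h \c g).
Proof.
rewrite /beq; case: (cid _) => k [k1 k2]; case: (cid _) => l [l1 l2] /=.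
by apply: (delta_map Pbe (f := h)); rewrite ?k1 ?k2.
Qed.

(** This is [be_compat] pulled back along an arrow into [U] whose components have components
    [(f, g)] and [(f', g')]. *)
Lemma beq_compat (Z X : C) (f g f' g' : Hom Z X) :
  beq f g `&` beq f f' `&` beq g g' <= beq f' g'.
Proof.
pose W := some_wp Pbe [:: X; X].
pose U := some_wp Pbe [:: wp_ob W; wp_ob W].
have [h h1 h2] := wp_pair W f g.
have [h' h1' h2'] := wp_pair W f' g'.
have [k k1 k2] := wp_pair U h h'.
have [s s1 s2] := wp_pair W (wp1 W \c wp1 U) (wp1 W \c wp2 U).
have [s' s1' s2'] := wp_pair W (wp2 W \c wp1 U) (wp2 W \c wp2 U).
have := reindex_le k (be_compat Pbe s1 s2 s1' s2').
rewrite !reindex_meet -!reindex_comp !beqE k1 k2 !compA s1 s2 s1' s2'.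
by rewrite -!compA k1 k2 h1 h2 h1' h2'.
Qed.

Lemma irr_subst (X : seq C) (W : weak_product X) (a : P W) (Z : C)
    (f g : Hom Z W) :
  proof_irrelevant delta a ->
  reindex P f a `&` \meet_(i < size X) beq (wp_proj W i \c f) (wp_proj W i \c g)
    <= reindex P g a.
Proof.
move=> irr; pose Q i : weak_square (@ob_at C X i) := some_wp Pbe _.
have t i : {t : Hom Z (Q i) | wp1 (Q i) \c t = wp_proj W i \c f
                            & wp2 (Q i) \c t = wp_proj W i \c g}.
  exact/cid2/wp_pair.
have := proof_irrelevantP Pbe irr (t := fun i => s2val (t i))
  (fun i => s2valP (t i)) (fun i => s2valP' (t i)).
by under eq_bigr do rewrite beqE (s2valP (t _)) (s2valP' (t _)).
Qed.

Lemma irr_intro (X : seq C) (W : weak_product X) (a : P W) :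
  (forall (Z : C) (f g : Hom Z W),
    reindex P f a `&` \meet_(i < size X) beq (wp_proj W i \c f) (wp_proj W i \c g)
      <= reindex P g a) ->
  proof_irrelevant delta a.
Proof.
move=> irr; apply: (proof_irrelevant_intro Pbe) => U Q t t1 t2.
by under eq_bigr do rewrite beqE t1 t2; apply: irr.
Qed.

(** The [j]-th component shared by all arrows over [F] out of [W]. *)
Definition leg (X Y : seq C) (F : pc_hom X Y) (W : weak_product X)
    (j : 'I_(size Y)) : Hom W (ob_at j) :=
  pc_arr F j \c wp_proj W (pc_idx F j).

Lemma leg_comp (X Y Z : seq C) (G : pc_hom Y Z) (F : pc_hom X Y)
    (W : weak_product X) k :
  leg (pc_comp G F) W k = pc_arr G k \c leg F W (pc_idx G k).
Proof. by rewrite /leg compA. Qed.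

Lemma leg_over (X Y Z : seq C) (G : pc_hom Y Z) (F : pc_hom X Y)
    (W : weak_product X) (V : weak_product Y) (g : Hom W V) k :
  pc_over F g -> leg G V k \c g = leg (pc_comp G F) W k.
Proof. by move=> gF; rewrite leg_comp /leg -compA gF. Qed.

Definition beqs (X Y : seq C) (F G : pc_hom X Y) (W : weak_product X) : P W :=
  \meet_(j < size Y) beq (leg F W j) (leg G W j).

(** To replace [f] by [g], [beq_compat] transports the [j]-th equality. The two auxiliary equalities
    it needs come from components [pc_idx F j] and [pc_idx G j] of the hypothesis, by congruence
    along [pc_arr F j] and [pc_arr G j]. *)
Lemma beqs_irr (X Y : seq C) (F G : pc_hom X Y) (W : weak_product X) :
  proof_irrelevant delta (beqs F G W).
Proof.
apply: irr_intro => Z f g; rewrite !reindex_meets; apply/meetsP => j _.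
rewrite !reindex_beq; apply: le_trans (beq_compat (leg F W j \c f) (leg G W j \c f) _ _).
rewrite !lexI -andbA; apply/and3P; split.
- by apply/leIxl/meets_max => //; rewrite reindex_beq.
- apply/leIxr/(@meets_max _ _ _ (pc_idx F j)) => //.
  by rewrite /leg -!compA beq_map.
- apply/leIxr/(@meets_max _ _ _ (pc_idx G j)) => //.
  by rewrite /leg -!compA beq_map.
Qed.

Definition strict_eq (X Y : seq C) (F G : pc_hom X Y) : strict_fib Pbe X :=
  match X return pc_hom X Y -> pc_hom X Y -> strict_fib Pbe X with
  | [::] => fun _ _ => \top
  | _ :: _ => fun F G => cls Pbe (PiElement (beqs_irr F G (some_wp Pbe _)))
  end F G.

Lemma reindex_beqs (X Y Z : seq C) (F G : pc_hom Y Z) (H : pc_hom X Y)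
    (W : weak_product X) (V : weak_product Y) (g : Hom W V) :
  pc_over H g -> reindex P g (beqs F G V) = beqs (pc_comp F H) (pc_comp G H) W.
Proof.
move=> gH; rewrite reindex_meets; apply: eq_bigr => j _.
by rewrite reindex_beq !(leg_over _ _ gH).
Qed.

Lemma strict_eq_top (X Y : seq C) (F G : pc_hom X Y) :
  (forall W, beqs F G W = \top) -> strict_eq F G = \top.
Proof.
case: X F G => [//|x X] F G top_FG; apply/clsP; exists (idc _).
  by move=> i; rewrite compc1.
by rewrite /= reindex_id top_FG.
Qed.

Lemma strict_eq_refl (X Y : seq C) (F : pc_hom X Y) : strict_eq F F = \top.
Proof. by apply: strict_eq_top => W; apply: big1 => j _; apply: beq_refl. Qed.

Lemma strict_eq_reindex (X Y Z : seq C) (F G : pc_hom Y Z) (H : pc_hom X Y) :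
  strict_reindex H (strict_eq F G) = strict_eq (pc_comp F H) (pc_comp G H).
Proof.
case: Y F G H => [|y Y] F G H.
  (* No arrow goes from the empty list to a non-empty one, so [Z] is empty too and both equalities
     are empty meets. *)
  case: Z F G => [|z Z] F G; last by case: (pc_idx F ord0).
  rewrite strict_eq_top ?strict_reindex_top; last by move=> W; apply: big_ord0.
  by rewrite strict_eq_top // => W; apply: big_ord0.
case: X H => [|x X] H; first by case: (pc_idx H ord0).
have [g gH] := over_exists H (some_wp Pbe (x :: X)) (some_wp Pbe (y :: Y)).
rewrite /= (cls_reindexE Pbe (b := PiElement _) gH).
apply/clsP; exists (idc _) => /=; first by move=> i; rewrite compc1.
by rewrite reindex_id (reindex_beqs _ _ gH).
Qed.

Lemma strict_eq_subst (X Y : seq C) (F G : pc_hom X Y) (a : strict_fib Pbe Y) :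
  strict_reindex F a `&` strict_eq F G <= strict_reindex G a.
Proof.
case: Y F G a => [|y Y] F G a.
  (* Reindexing out of the singleton fibre is constantly top. *)
  by rewrite [leRHS](_ : _ = \top) ?lex1 //; case: X F G.
case: X F G => [//|x X] F G; move: a; apply: clsW => -[V a irr_a].
set W := some_wp Pbe (x :: X).
have [f fF] := over_exists F W V; have [g gG] := over_exists G W V.
rewrite /= (cls_reindexE Pbe (b := PiElement _) fF).
rewrite (cls_reindexE Pbe (b := PiElement _) gG) cls_meetE.
apply/cls_leE; exists (idc _) => /=; first by move=> i; rewrite compc1.
rewrite reindex_id; apply: le_trans (irr_subst f g irr_a).
by under [X in _ `&` X <= _]eq_bigr do rewrite /leg -fF -gG.
Qed.

(** Every index of [Y ++ Z] comes from [Y] or from [Z]; congruence along the inverse of the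
    transport [hom_of_eq] cancels the one inside the projection. *)
Lemma strict_eq_pair (X Y Z : seq C) (F G : pc_hom X (Y ++ Z)) :
  strict_eq (pc_comp (pc_fst Y Z) F) (pc_comp (pc_fst Y Z) G)
    `&` strict_eq (pc_comp (pc_snd Y Z) F) (pc_comp (pc_snd Y Z) G)
  <= strict_eq F G.
Proof.
case: X F G => [//|x X] F G; rewrite /= cls_meetE.
apply/cls_leE; exists (idc _) => /=; first by move=> i; rewrite compc1.
rewrite reindex_id; apply/meetsP => i _.
case: (cat_case i) => -[j <-].
  apply/leIxl/(@meets_max _ _ _ j) => //; rewrite !leg_comp /=.
  by apply: le_trans (beq_map (hom_of_eq (esym (ob_at_inl Z j))) _ _) _;
    rewrite !hom_of_eqVK.
apply/leIxr/(@meets_max _ _ _ j) => //; rewrite !leg_comp /=.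
by apply: le_trans (beq_map (hom_of_eq (esym (ob_at_inr Y j))) _ _) _;
  rewrite !hom_of_eqVK.
Qed.

Lemma strictification_elementary : elementary (pc_products C) (strictification Pbe).
Proof.
exists (fun X : seq C => strict_eq (pc_fst X X) (pc_snd X X)).
have fstP (X Y Z : seq C) (F : pc_hom Z X) (G : pc_hom Z Y) :
  pc_comp (pc_fst X Y) (pc_pair F G) = F := @fp_pair_fst _ (pc_products C) X Y Z F G.
have sndP (X Y Z : seq C) (F : pc_hom Z X) (G : pc_hom Z Y) :
  pc_comp (pc_snd X Y) (pc_pair F G) = G := @fp_pair_snd _ (pc_products C) X Y Z F G.
split=> [X | X a | X Y].
- by rewrite /= strict_eq_reindex /diag /= fstP sndP strict_eq_refl.
- exact: strict_eq_subst.
(* Here [F] and [G] are the two projections of the square of [X ++ Y]. *)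
- apply: le_trans (strict_eq_pair _ _).
  by rewrite /= !strict_eq_reindex /pair13 /pair24 /= !fstP !sndP.
Qed.

End BiasedEquality.

(** * Equality predicates in a strict elementary doctrine *)

Section StrictEquality.
Variables (d : Order.disp_t) (D : category) (FP : finite_products D).
Variables (R : doctrine d D) (delta : forall X : D, R (fp_prod FP X X)).
Hypothesis delta_refl : forall X, \top <= reindex R (diag FP X) (delta X).
Hypothesis delta_subst : forall X (a : R X),
  reindex R (fp_fst FP X X) a `&` delta X <= reindex R (fp_snd FP X X) a.
Hypothesis delta_prod : forall X Y,
  reindex R (pair13 FP X Y) (delta X) `&` reindex R (pair24 FP X Y) (delta Y)
    <= delta (fp_prod FP X Y).

Definition deq (Z X : D) (f g : Hom Z X) : R Z :=
  reindex R (fp_pair FP f g) (delta X).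

Lemma fp_pair_comp (Y Z A B : D) (f : Hom Z A) (g : Hom Z B) (k : Hom Y Z) :
  fp_pair FP f g \c k = fp_pair FP (f \c k) (g \c k).
Proof. by rewrite -[LHS]fp_pair_uniq !compA fp_pair_fst fp_pair_snd. Qed.

Lemma reindex_deq (Y Z X : D) (k : Hom Y Z) (f g : Hom Z X) :
  reindex R k (deq f g) = deq (f \c k) (g \c k).
Proof. by rewrite /deq -reindex_comp fp_pair_comp. Qed.

Lemma deq_refl (Z X : D) (f : Hom Z X) : deq f f = \top.
Proof.
apply/le_anti; rewrite lex1 -(reindex_top R f) /=.
apply: le_trans (reindex_le f (delta_refl X)) _.
by rewrite -reindex_comp fp_pair_comp comp1c.
Qed.

Lemma deq_subst (Z X : D) (f g : Hom Z X) (a : R X) :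
  reindex R f a `&` deq f g <= reindex R g a.
Proof.
have := reindex_le (fp_pair FP f g) (delta_subst a).
by rewrite reindex_meet -!reindex_comp fp_pair_fst fp_pair_snd.
Qed.

(** Pull [delta_prod] back along the pairing of [(f, g)] with [(f', g')]: [pair13] then selects
    [(f, f')] and [pair24] selects [(g, g')]. *)
Lemma deq_pair (Z X Y : D) (f f' : Hom Z X) (g g' : Hom Z Y) :
  deq f f' `&` deq g g' <= deq (fp_pair FP f g) (fp_pair FP f' g').
Proof.
have := reindex_le (fp_pair FP (fp_pair FP f g) (fp_pair FP f' g'))
  (delta_prod X Y).
rewrite reindex_meet -!reindex_comp /pair13 /pair24 !fp_pair_comp -!compA.
by rewrite !(fp_pair_fst, fp_pair_snd).
Qed.

(* Substitute along (f, f) = (f, g) in the element "h x = h y" over X x X. *)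
Lemma deq_map (Z X Y : D) (h : Hom X Y) (f g : Hom Z X) :
  deq f g <= deq (h \c f) (h \c g).
Proof.
have := deq_subst (fp_pair FP f f) (fp_pair FP f g)
  (deq (h \c fp_fst FP X X) (h \c fp_snd FP X X)).
rewrite !reindex_deq -!compA !fp_pair_fst !fp_pair_snd deq_refl meet1x.
by apply: le_trans; apply: le_trans (deq_pair _ _ _ _); rewrite deq_refl meet1x.
Qed.

(* Substitute along (f, g) = (f', g') in [delta X]. *)
Lemma deq_compat (Z X : D) (f g f' g' : Hom Z X) :
  deq f g `&` deq f f' `&` deq g g' <= deq f' g'.
Proof.
apply: le_trans (deq_subst (fp_pair FP f g) (fp_pair FP f' g') (delta X)).
by rewrite -meetA leI2 // deq_pair.
Qed.

End StrictEquality.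

(** * Precomposition with a functor, and the theorem *)

Lemma precomp_biased_elementary d (C D : category) (FP : finite_products D)
    (R : doctrine d D) (S : functor C D) :
  has_weak_products C -> elementary FP R ->
  exists delta : forall (X : C) (W : weak_square X), precomp R S W,
    biased_elementary delta.
Proof.
move=> C_wp [delta [refl subst prod]].
(* The image of [W] need not be a product, so [delta] is pulled back along the pairing of the images
   of its projections. *)
exists (fun X W => deq delta (fun_hom S (wp1 W)) (fun_hom S (wp2 W))).
split=> //= [X W h h1 h2|X W a|X X' W W' f g g1 g2|X W U t t' t1 t2 t1' t2'].
- by rewrite reindex_deq -!fun_comp h1 h2 deq_refl.
- exact: deq_subst.
- by rewrite reindex_deq -!fun_comp g1 g2 !fun_comp deq_map.
- by rewrite !reindex_deq -!fun_comp t1 t2 t1' t2' !fun_comp deq_compat.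
Qed.

Theorem theorem5p3 (C : category) (C_wp : has_weak_products C) :
  (forall (d : Order.disp_t) (P : doctrine d C)
      (delta : forall (X : C) (W : weak_square X), P W)
      (P_be : biased_elementary delta),
    elementary (pc_products C) (strictification P_be))
  /\
  (forall (d : Order.disp_t) (R : doctrine d (product_completion C)),
    elementary (pc_products C) R ->
    exists delta : forall (X : C) (W : weak_square X), precomp R (pc_embed C) W,
      biased_elementary delta).
Proof.
split=> [d P delta P_be|d R]; first exact: strictification_elementary.
exact: precomp_biased_elementary.
Qed.
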